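(* Let $d,n\in\mathbb{N}_+$, $\alpha\in(0,1]$ and $L\ge 0$. For every function $f:[0,1]^d\to[-n,n]$ which is $\alpha$-Hölder continuous with coefficient $L$, there exists a ReLU MLP $\Phi:\mathbb{R}^d\to\mathbb{R}$ belonging to $\mathcal{NN}^{L,\alpha,n}_{D,W}$ (so in particular $\Phi$ is $\alpha$-Hölder continuous with the same coefficient $L$ on $[0,1]^d$), where its width satisfies $$W\le 8d\left(\left\lceil \tfrac12\left(\tfrac{Ln}{d^{1-\alpha}}\right)^{1/\alpha}\right\rceil+1\right)^d,$$ its depth satisfies $D\le\lceil\log_2 d\rceil+4$, it has at most $$16d\left(\left\lceil \tfrac12\left(\tfrac{Ln}{d^{1-\alpha}}\right)^{1/\alpha}\right\rceil+1\right)^d$$ nonzero parameters, and $$\max_{\mathbf{x}\in[0,1]^d}|f(\mathbf{x})-\Phi(\mathbf{x})|\le\frac{d}{n}.$$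
   Context: Hölder continuity: a real-valued function $g$ on a set $X\subseteq\mathbb{R}^d$ is $\alpha$-Hölder with coefficient $L$ if $|g(\mathbf{x})-g(\mathbf{y})|\le L\|\mathbf{x}-\mathbf{y}\|_1^\alpha$ for all $\mathbf{x},\mathbf{y}\in X$ ($\ell^1$ norm). ReLU MLP: a function $\Phi:\mathbb{R}^{d_1}\to\mathbb{R}^{d_{\Delta+1}}$ with a representation $\mathbf{x}^{(1)}=\mathbf{x}$, $\mathbf{x}^{(l+1)}=\operatorname{ReLU}(\mathbf{W}^{(l)}\mathbf{x}^{(l)}+\mathbf{b}^{(l)})$ for $l=1,\dots,\Delta-1$ (ReLU$(t)=\max\{0,t\}$ applied componentwise), $\Phi(\mathbf{x})=\mathbf{W}^{(\Delta)}\mathbf{x}^{(\Delta)}+\mathbf{b}^{(\Delta)}$, where $\mathbf{W}^{(l)}\in\mathbb{R}^{d_{l+1}\times d_l}$ (weights) and $\mathbf{b}^{(l)}\in\mathbb{R}^{d_{l+1}}$ (biases). Its depth is $\Delta-1$ (number of hidden layers), its width is $\max_{2\le l\le\Delta}d_l$, and the number of nonzero parameters is the total number of nonzero entries of all $\mathbf{W}^{(l)},\mathbf{b}^{(l)}$. The class $\mathcal{NN}^{L,\alpha,n}_{D,W}$ consists of the real-valued ReLU MLPs $\Phi$ on $\mathbb{R}^d$ of depth at most $D$ and width at most $W$, which are $\alpha$-Hölder with coefficient $L$ on $[0,1]^d$, and which have a representation $\mathbf{x}^{(1)}=\mathbf{x}$, $\mathbf{x}^{(l+1)}=\operatorname{ReLU}(\mathbf{W}^{(l)}\mathbf{x}^{(l)}+\mathbf{b}^{(l)})$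 for $l=1,\dots,\Delta-1$, $\Phi(\mathbf{x})=\mathbf{W}^{(\Delta)}\mathbf{x}^{(\Delta)}+\mathbf{b}^{(\Delta)}$ in which all weights and biases of the first and last layers ($l=1$ and $l=\Delta$) have absolute value at most $n$, while in all other layers all biases are $0$ and all weights lie in $\{0,\pm\frac12\}$. *)

(* Defs.v *)
From mathcomp Require Import all_boot all_order all_algebra.
From mathcomp Require Import all_classical all_reals all_analysis.

Set Implicit Arguments.
Unset Strict Implicit.
Unset Printing Implicit Defensive.

Import Order.TTheory GRing.Theory Num.Theory.

Local Open Scope classical_set_scope.
Local Open Scope ring_scope.

Definition norm1 (R : realType) (d : nat) (x : 'cV[R]_d) : R :=
  \sum_(i < d) `|x i 0|.

Definition unit_cube (R : realType) (d : nat) : set 'cV[R]_d :=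
  [set x | forall i : 'I_d, 0 <= x i 0 <= 1].

Definition holder_on (R : realType) (d : nat) (X : set 'cV[R]_d)
    (L alpha : R) (g : 'cV[R]_d -> R) : Prop :=
  forall x y, X x -> X y -> `|g x - g y| <= L * norm1 (x - y) `^ alpha.

Definition relu (R : realType) (m : nat) (v : 'cV[R]_m) : 'cV[R]_m :=
  \col_(i < m) Num.max 0 (v i 0).

(* A representation of a ReLU MLP from R^m to R^k, listed from the input side:
   [Hidden A b N] applies x |-> relu (A x + b) and passes the result to N;
   [Output A b] is the final affine layer, without activation. *)
Inductive mlp (R : realType) (k : nat) : nat -> Type :=
| Output (m : nat) (A : 'M[R]_(k, m)) (b : 'cV[R]_k) : mlp R k m
| Hidden (m p : nat) (A : 'M[R]_(p, m)) (b : 'cV[R]_p) (N : mlp R k p) :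
    mlp R k m.

Fixpoint mlp_eval (R : realType) (k m : nat) (N : mlp R k m) :
    'cV[R]_m -> 'cV[R]_k :=
  match N in mlp _ _ m return 'cV[R]_m -> 'cV[R]_k with
  | Output _ A b => fun x => A *m x + b
  | Hidden _ _ A b N' => fun x => mlp_eval N' (relu (A *m x + b))
  end.

Definition mlp_fun (R : realType) (d : nat) (N : mlp R 1 d) (x : 'cV[R]_d) : R :=
  mlp_eval N x 0 0.

Fixpoint mlp_depth (R : realType) (k m : nat) (N : mlp R k m) : nat :=
  match N with
  | Output _ _ _ => 0
  | Hidden _ _ _ _ N' => (mlp_depth N').+1
  end.

Fixpoint mlp_width (R : realType) (k m : nat) (N : mlp R k m) : nat :=
  match N with
  | Output _ _ _ => 0
  | Hidden _ p _ _ N' => maxn p (mlp_width N')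
  end.

Definition nnz (R : realType) (p m : nat) (A : 'M[R]_(p, m)) : nat :=
  (\sum_(i < p) \sum_(j < m) (A i j != 0%R))%N.

Fixpoint mlp_nnz (R : realType) (k m : nat) (N : mlp R k m) : nat :=
  match N with
  | Output _ A b => (nnz A + nnz b)%N
  | Hidden _ _ A b N' => (nnz A + nnz b + mlp_nnz N')%N
  end.

Definition entries_le (R : realType) (p m : nat) (c : R) (A : 'M[R]_(p, m)) :
  Prop := forall i j, `|A i j| <= c.

Definition half_entries (R : realType) (p m : nat) (A : 'M[R]_(p, m)) : Prop :=
  forall i j, A i j \in [:: 0; 2^-1; - 2^-1].

(* The condition on the layers l = 2, ..., Delta. *)
Fixpoint admissible_tail (R : realType) (k m : nat) (c : R) (N : mlp R k m) :
    Prop :=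
  match N with
  | Output _ A b => entries_le c A /\ entries_le c b
  | Hidden _ _ A b N' => [/\ half_entries A, b = 0 & admissible_tail c N']
  end.

(* A network consisting of a single affine layer has that layer both as its
   first and as its last one. *)
Definition admissible (R : realType) (k m : nat) (c : R) (N : mlp R k m) :
    Prop :=
  match N with
  | Output _ A b => entries_le c A /\ entries_le c b
  | Hidden _ _ A b N' =>
      [/\ entries_le c A, entries_le c b & admissible_tail c N']
  end.

(* NN^{L,alpha,n}_{D,W}, as a set of representations, so that the number of
   nonzero parameters of a member makes sense. *)
Definition NN (R : realType) (d : nat) (L alpha : R) (n D W : nat) :
    set (mlp R 1 d) :=
  [set N | [/\ (mlp_depth N <= D)%N, (mlp_width N <= W)%N,
               holder_on (@unit_cube R d) L alpha (mlp_fun N)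
             & admissible n%:R N]].

Definition grid_size (R : realType) (d n : nat) (L alpha : R) : int :=
  Num.ceil (2^-1 * (L * n%:R / d%:R `^ (1 - alpha)) `^ alpha^-1).

Definition log2 (R : realType) (x : R) : R := ln x / ln 2.

(* Main.v *)
(* Write g for the grid size and interpolate f linearly on the Kuhn triangulation
   of the grid (1/g)Z^d.  With u = g x, the interpolant at x is the average over
   t in [0,1) of f(floor(u + t)/g), floor being taken coordinatewise.  As floor
   is monotone, the average of |floor(u_i + t) - floor(v_i + t)| is |u_i - v_i|,
   so concavity of s^alpha (Jensen) gives the Hölder constant L of f itself.  The
   average of |u_i - floor(u_i + t)| is 2 th (1 - th) <= 1/2, th being the
   fractional part of u_i, which gives the error bound L (d/(2g))^alpha <= d/n.

   The coefficient of f(k/g) in this average is the measure of an interval,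
   hat_k(u) = relu(1 - max_i(u_i - k_i)^+ - max_i(k_i - u_i)^+).  The network
   computes |f(k/g)| hat_k(g x)/g from |f(k/g)| (x_i - k_i/g) with binary trees of
   maxima, every layer halving the scale; it then gathers the nodes with
   f(k/g) >= 0 and those with f(k/g) < 0 into one neuron each, and recovers the
   scale by summing many copies of these two neurons in the output layer. *)

Require Import Defs.
From mathcomp Require Import all_boot all_order all_algebra.
From mathcomp Require Import all_classical all_reals all_analysis.
From mathcomp Require Import zify ring lra.
Import Order.TTheory GRing.Theory Num.Theory.
Local Open Scope classical_set_scope.
Local Open Scope ring_scope.

Set Implicit Arguments.
Unset Strict Implicit.
Unset Printing Implicit Defensive.

(** * Networks as sequences of layers *)

Section Networks.
Variable R : realType.

Lemma nnz_le (p m : nat) (A : 'M[R]_(p, m)) : (nnz A <= p * m)%N.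
Proof.
have -> : (p * m = \sum_(i < p) \sum_(j < m) 1)%N.
  by rewrite !sum_nat_const !card_ord muln1.
by apply: leq_sum => i _; apply: leq_sum => j _; case: eqP.
Qed.

Lemma nnz0 (p m : nat) : nnz (0 : 'M[R]_(p, m)) = 0%N.
Proof. by rewrite /nnz big1// => i _; rewrite big1// => j _; rewrite mxE eqxx. Qed.

Lemma nnz_col_mx (p q m : nat) (A : 'M[R]_(p, m)) (B : 'M[R]_(q, m)) :
  nnz (col_mx A B) = (nnz A + nnz B)%N.
Proof.
rewrite /nnz big_split_ord/=; congr (_ + _)%N; apply: eq_bigr => i _;
  by apply: eq_bigr => j _; rewrite ?col_mxEu ?col_mxEd.
Qed.

Lemma nnz_row_mx (p m k : nat) (A : 'M[R]_(p, m)) (B : 'M[R]_(p, k)) :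
  nnz (row_mx A B) = (nnz A + nnz B)%N.
Proof.
rewrite /nnz -big_split/=; apply: eq_bigr => i _.
by rewrite big_split_ord/=; congr (_ + _)%N; apply: eq_bigr => j _;
  rewrite ?row_mxEl ?row_mxEr.
Qed.

Lemma nnz_block_mx (p q m k : nat) (A : 'M[R]_(p, m)) (B : 'M[R]_(p, k))
    (C : 'M[R]_(q, m)) (D : 'M[R]_(q, k)) :
  nnz (block_mx A B C D) = (nnz A + nnz B + (nnz C + nnz D))%N.
Proof. by rewrite /block_mx nnz_col_mx !nnz_row_mx. Qed.

Lemma relu_col_mx (p q : nat) (u : 'cV[R]_p) (v : 'cV[R]_q) :
  relu (col_mx u v) = col_mx (relu u) (relu v).
Proof.
by apply/matrixP => i j; rewrite !mxE; case: splitP => k _; rewrite mxE.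
Qed.

Lemma relu_const_mx (p : nat) (a : R) :
  relu (const_mx a : 'cV_p) = const_mx (Num.max 0 a).
Proof. by apply/matrixP => i j; rewrite !mxE. Qed.

Lemma entries_le_const (p m : nat) (c a : R) :
  `|a| <= c -> entries_le c (const_mx a : 'M[R]_(p, m)).
Proof. by move=> ac i j; rewrite mxE. Qed.

Lemma entries_le_col_mx (p q m : nat) (c : R) (A : 'M[R]_(p, m)) (B : 'M[R]_(q, m)) :
  entries_le c A -> entries_le c B -> entries_le c (col_mx A B).
Proof. by move=> hA hB i j; rewrite mxE; case: splitP. Qed.

Lemma entries_le_row_mx (p m k : nat) (c : R) (A : 'M[R]_(p, m)) (B : 'M[R]_(p, k)) :
  entries_le c A -> entries_le c B -> entries_le c (row_mx A B).
Proof. by move=> hA hB i j; rewrite mxE; case: splitP. Qed.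

Lemma half_entries_const (p m : nat) (a : R) :
  a \in [:: 0; 2^-1; - 2^-1] -> half_entries (const_mx a : 'M[R]_(p, m)).
Proof. by move=> ha i j; rewrite mxE. Qed.

Lemma half_entries_col_mx (p q m : nat) (A : 'M[R]_(p, m)) (B : 'M[R]_(q, m)) :
  half_entries A -> half_entries B -> half_entries (col_mx A B).
Proof. by move=> hA hB i j; rewrite mxE; case: splitP. Qed.

Lemma half_entries_row_mx (p m k : nat) (A : 'M[R]_(p, m)) (B : 'M[R]_(p, k)) :
  half_entries A -> half_entries B -> half_entries (row_mx A B).
Proof. by move=> hA hB i j; rewrite mxE; case: splitP. Qed.

Lemma half_mem0 : (0 : R) \in [:: 0; 2^-1; - 2^-1].
Proof. by rewrite inE eqxx. Qed.

Lemma half_memP : (2^-1 : R) \in [:: 0; 2^-1; - 2^-1].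
Proof. by rewrite !inE eqxx orbT. Qed.

Lemma half_memN : (- 2^-1 : R) \in [:: 0; 2^-1; - 2^-1].
Proof. by rewrite !inE eqxx !orbT. Qed.

Lemma mul_const_mx (m q k : nat) (a : R) (v : 'M[R]_(m, q)) :
  (const_mx a : 'M[R]_(k, m)) *m v = \matrix_(i, j) (a * \sum_l v l j).
Proof.
apply/matrixP => i j; rewrite !mxE mulr_sumr.
by apply: eq_bigr => l _; rewrite mxE.
Qed.

Variables (d : nat) (c : R).

(* [reach t w N q G]: the map [G] is computed by the first t + 1 hidden layers
   of an admissible network (entries of the first layer bounded by [c]) with
   layers of width at most [w] and at most [N] nonzero parameters. *)
Fixpoint reach (t w N q : nat) (G : 'cV[R]_d -> 'cV[R]_q) : Prop :=
  match t with
  | 0 => exists A b, [/\ entries_le c A, entries_le c b, (q <= w)%N,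
           (nnz A + nnz b <= N)%N & forall x, G x = relu (A *m x + b)]
  | t'.+1 => exists p (F : 'cV[R]_d -> 'cV[R]_p) N' A,
      [/\ reach t' w N' F, half_entries A, (q <= w)%N, (N' + nnz A <= N)%N
        & forall x, G x = relu (A *m F x)]
  end.

Lemma reach_le (t w w' N N' q : nat) (G : 'cV_d -> 'cV_q) :
  (w <= w')%N -> (N <= N')%N -> reach t w N G -> reach t w' N' G.
Proof.
elim: t N N' q G => [|t IH] N N' q G ww NN /=.
  by move=> [A [b [hA hb hq hN hG]]]; exists A, b; split=> //; lia.
move=> [p [F [N0 [A [hF hA hq hN hG]]]]]; exists p, F, N0, A; split=> //; try lia.
exact: IH hF.
Qed.

Lemma reach_step (t w N p q : nat) (F : 'cV_d -> 'cV_p) (A : 'M[R]_(q, p)) :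
  reach t w N F -> half_entries A -> (q <= w)%N ->
  reach t.+1 w (N + nnz A) (fun x => relu (A *m F x)).
Proof. by move=> hF hA qw; exists p, F, N, A. Qed.

(** Block-diagonal weights put two networks side by side; the zero blocks are permitted weights and
    cost no parameters. Both must have the same depth, which is why shallow branches get delayed
    below. *)
Lemma reach_col_mx (t w1 w2 N1 N2 p q : nat)
    (F : 'cV_d -> 'cV_p) (G : 'cV_d -> 'cV_q) :
  reach t w1 N1 F -> reach t w2 N2 G ->
  reach t (w1 + w2) (N1 + N2) (fun x => col_mx (F x) (G x)).
Proof.
elim: t N1 N2 p q F G => [|t IH] N1 N2 p q F G /=.
  move=> [A [a [hA ha pw1 hN1 hF]]] [B [b [hB hb qw2 hN2 hG]]].
  exists (col_mx A B), (col_mx a b).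
  split; [exact: entries_le_col_mx|exact: entries_le_col_mx|lia| |].
    by rewrite !nnz_col_mx; lia.
  by move=> x; rewrite mul_col_mx add_col_mx relu_col_mx hF hG.
move=> [p' [F' [M1 [A [hF' hA pw hM1 hF]]]]].
move=> [q' [G' [M2 [B [hG' hB qw hM2 hG]]]]].
exists (p' + q')%N, (fun x => col_mx (F' x) (G' x)), (M1 + M2)%N, (block_mx A 0 0 B).
split; [exact: IH| |lia| |].
- by apply: half_entries_col_mx; apply: half_entries_row_mx => //;
    apply: half_entries_const; exact: half_mem0.
- by rewrite nnz_block_mx !nnz0; lia.
- by move=> x; rewrite mul_block_col !mul0mx addr0 add0r relu_col_mx hF hG.
Qed.

Lemma reach_empty (t : nat) (G : 'cV_d -> 'cV_0) : reach t 0 0 G.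
Proof.
elim: t G => [|t IH] G /=.
  exists 0, 0; split=> //; try by move=> [].
    by rewrite !nnz0.
  by move=> x; apply/matrixP => -[].
exists 0, (fun=> 0), 0%N, 0; split=> //; first by move=> [].
  by rewrite nnz0.
by move=> x; apply/matrixP => -[].
Qed.

Lemma reach_ext (t w N q : nat) (F G : 'cV_d -> 'cV_q) :
  F =1 G -> reach t w N F -> reach t w N G.
Proof. by move=> /funext ->. Qed.

Lemma reach_col (t w N m : nat) (g : 'I_m -> 'cV[R]_d -> R) :
  (forall i, reach t w N (fun x => const_mx (g i x) : 'cV_1)) ->
  reach t (m * w) (m * N) (fun x => \col_i g i x).
Proof.
elim: m g => [|m IH] g hg; first exact: reach_empty.
have := reach_col_mx (hg ord0) (IH (fun i => g (lift ord0 i)) (fun i => hg _)).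
apply: (@reach_ext t _ _ (1 + m)) => x; apply/matrixP => i j; rewrite !mxE.
case: splitP => k ik; rewrite mxE; congr (g _ _); apply: val_inj.
  by rewrite /= ik (ord1 k).
by rewrite /= ik.
Qed.

(** [reach] grows at the output end and [mlp] at the input end, so the induction moves the last
    layer of [G] onto [Psi]. *)
Lemma reach_mlp (k t w N q : nat) (G : 'cV_d -> 'cV_q) (Psi : mlp R k q) :
  reach t w N G -> admissible_tail c Psi ->
  exists Phi : mlp R k d,
    [/\ mlp_depth Phi = (t.+1 + mlp_depth Psi)%N,
        (mlp_width Phi <= maxn w (mlp_width Psi))%N,
        (mlp_nnz Phi <= N + mlp_nnz Psi)%N, admissible c Phi
      & forall x, mlp_eval Phi x = mlp_eval Psi (G x)].
Proof.
elim: t N q G Psi => [|t IH] N q G Psi /=.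
  move=> [A [b [hA hb qw hN hG]]] hPsi; exists (Hidden A b Psi); split=> //=.
  - by rewrite geq_max leq_maxr andbT leq_max qw.
  - by rewrite leq_add2r.
  - by move=> x; rewrite hG.
move=> [p [F [N' [A [hF hA qw hN hG]]]]] hPsi.
have [|Phi [h1 h2 h3 h4 h5]] := IH _ _ _ (Hidden A 0 Psi) hF; first by split.
exists Phi; split=> //.
- by rewrite h1 /= addnS.
- move: h2 => /=; lia.
- by move: h3 => /=; rewrite nnz0; lia.
- by move=> x; rewrite h5/= addr0 hG.
Qed.

End Networks.

(** * Building blocks *)

Lemma sum_col_mx (R : realType) (p q : nat) (u : 'cV[R]_p) (v : 'cV[R]_q) :
  \sum_i col_mx u v i 0 = \sum_i u i 0 + \sum_i v i 0.
Proof.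
rewrite big_split_ord; congr (_ + _); apply: eq_bigr => i _.
  by rewrite col_mxEu.
by rewrite col_mxEd.
Qed.

Lemma mul_const_const_mx (R : realType) (k m p : nat) (a b : R) :
  (const_mx a : 'M[R]_(k, m)) *m (const_mx b : 'M[R]_(m, p)) =
  const_mx (m%:R * (a * b)).
Proof.
apply/matrixP => i j; rewrite mul_const_mx !mxE.
under eq_bigr do rewrite mxE.
by rewrite sumr_const card_ord mulrnAr mulr_natl.
Qed.

Section Blocks.
Variables (R : realType) (d : nat) (c : R).

Lemma reach_affine (i : 'I_d) (s b : R) : `|s| <= c -> `|b| <= c ->
  reach c 0 1 2 (fun x : 'cV_d => const_mx (Num.max 0 (s * x i 0 + b)) : 'cV_1).
Proof.
move=> sc bc; exists (s *: delta_mx 0 i), (const_mx b); split=> //.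
- move=> k j; rewrite !mxE (ord1 k) eqxx/=.
  by case: eqP => _; rewrite ?mulr1// mulr0 normr0 (le_trans _ sc).
- exact: entries_le_const.
- rewrite (@leq_add _ _ 1 1)//; last by apply: leq_trans (nnz_le _) _.
  rewrite /nnz big_ord1 (bigD1 i)//= big1 ?addn0; first by case: eqP.
  by move=> j ji; rewrite !mxE (negbTE ji) andbF mulr0 eqxx.
- move=> x; apply/matrixP => k j; rewrite !mxE (ord1 k) (bigD1 i)//= big1.
    by rewrite addr0 !mxE !eqxx mulr1.
  by move=> l li; rewrite !mxE (negbTE li) andbF mulr0 mul0r.
Qed.

Lemma reach_const (b : R) : 0 <= b <= c ->
  reach c 0 1 1 (fun=> const_mx b : 'cV_1) (d := d).
Proof.
move=> /andP[b0 bc]; exists 0, (const_mx b); split=> //.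
- by move=> k j; rewrite mxE normr0 (le_trans b0).
- by apply: entries_le_const; rewrite ger0_norm.
- by rewrite nnz0 add0n; apply: leq_trans (nnz_le _) _.
- by move=> x; rewrite mul0mx add0r relu_const_mx; congr const_mx; rewrite max_r.
Qed.

Lemma reach_halve (t w N : nat) (g : 'cV_d -> R) : (forall x, 0 <= g x) ->
  reach c t w N (fun x => const_mx (g x) : 'cV_1) -> (0 < w)%N ->
  reach c t.+1 w N.+1 (fun x => const_mx (2^-1 * g x) : 'cV_1).
Proof.
move=> g0 hg w0.
have hN : (N + nnz (const_mx 2^-1 : 'M[R]_(1, 1)) <= N.+1)%N.
  by have := nnz_le (const_mx 2^-1 : 'M[R]_(1, 1)); lia.
have := reach_step hg (@half_entries_const _ 1 1 _ (half_memP R)) w0.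
move/(reach_le (leqnn w) hN); apply: reach_ext => x.
rewrite mul_const_mx; apply/matrixP => i j; rewrite !mxE big_ord1 mxE max_r//.
by rewrite mulr_ge0.
Qed.

(** Keeps a first-layer neuron in step with a branch [t] layers deeper. The largest weight available
    is 1/2, so each layer costs one parameter and halves the value. *)
Lemma reach_delay (t w N : nat) (g : 'cV_d -> R) : (forall x, 0 <= g x) ->
  reach c 0 w N (fun x => const_mx (g x) : 'cV_1) -> (0 < w)%N ->
  reach c t w (N + t) (fun x => const_mx (2^-1 ^+ t * g x) : 'cV_1).
Proof.
move=> g0 hg w0; elim: t => [|t IH].
  by rewrite addn0; apply: reach_ext hg => x; rewrite mul1r.
rewrite addnS; apply: reach_ext (reach_halve _ IH w0) => x.
  by rewrite exprS mulrA.
by rewrite mulr_ge0// exprn_ge0.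
Qed.

(* The function [g] is a sum of [q] neurons after [t] layers, computed from
   the [n] inputs of a tree of maxima.  The surplus [3 * (q == 1)] makes the
   bound on the number of parameters stable under [sum_rep_max]. *)
Definition sum_rep (t n q : nat) (g : 'cV[R]_d -> R) : Prop :=
  exists N (G : 'cV[R]_d -> 'cV[R]_q),
    [/\ reach c t (2 * n) N G, (0 < q <= 2)%N,
        (2 * N + 12 <= 11 * n + 2 ^ t.+1 + 3 * (q == 1))%N
      & forall x, \sum_i G x i 0 = g x].

(* max(a, b) = relu(a - b) + relu(b) for nonnegative a, b. *)
Lemma sum_rep_max (t n1 n2 q1 q2 : nat) (g1 g2 : 'cV_d -> R) :
  (0 < n1)%N -> (q2 <= q1)%N -> (forall x, 0 <= g2 x) ->
  sum_rep t n1 q1 g1 -> sum_rep t n2 q2 g2 ->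
  sum_rep t.+1 (n1 + n2) 2 (fun x => 2^-1 * Num.max (g1 x) (g2 x)).
Proof.
move=> n10 q21 g20 [N1 [G1 [hG1 hq1 hN1 sG1]]] [N2 [G2 [hG2 hq2 hN2 sG2]]].
(* The rows compute (a - b)/2 and b/2, where a and b are sums of [q1] and [q2] neurons; b occurs
   twice, so its neurons count double in [nA]. *)
pose A : 'M[R]_(1 + 1, q1 + q2) := col_mx
  (row_mx (const_mx 2^-1) (const_mx (- 2^-1))) (row_mx 0 (const_mx 2^-1)).
have hA : half_entries A.
  by apply: half_entries_col_mx; apply: half_entries_row_mx;
    apply: half_entries_const;
    [exact: half_memP|exact: half_memN|exact: half_mem0|exact: half_memP].
have nA : (nnz A <= q1 + 2 * q2)%N.
  rewrite nnz_col_mx !nnz_row_mx nnz0.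
  have := nnz_le (const_mx 2^-1 : 'M[R]_(1, q1)).
  have := nnz_le (const_mx 2^-1 : 'M[R]_(1, q2)).
  have := nnz_le (const_mx (- 2^-1) : 'M[R]_(1, q2)).
  lia.
have w2 : (1 + 1 <= 2 * n1 + 2 * n2)%N by lia.
have hG := reach_step (reach_col_mx hG1 hG2) hA w2.
exists (N1 + N2 + nnz A)%N, (fun x => relu (A *m col_mx (G1 x) (G2 x))).
split=> //; first by rewrite mulnDr.
  (* This amounts to 3 (e1 + e2) + 2 (q1 + 2 q2) <= 12, where ei = 1 if qi = 1 and 0 otherwise. It
     holds for (q1, q2) = (1, 1), (2, 1), (2, 2) and fails for (1, 2), which [q2 <= q1] excludes. *)
  by move: (expnS 2 t.+1); case: eqP hN1; case: eqP hN2 => /=; lia.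
move=> x; rewrite mul_col_mx !mul_row_col mul0mx add0r relu_col_mx.
rewrite (@sum_col_mx R 1 1) !big_ord1.
rewrite !mul_const_mx !mxE sG1 sG2.
have := g20 x; rewrite /Num.max; do !case: ifP => ?; lra.
Qed.

Lemma bigmax0_ge0 (I : Type) (r : seq I) (F : I -> R) :
  0 <= \big[Num.max/0]_(i <- r) F i.
Proof. exact: bigmax_ge_id. Qed.

Lemma bigmax0_cat (I : Type) (r s : seq I) (F : I -> R) :
  \big[Num.max/0]_(i <- r ++ s) F i =
  Num.max (\big[Num.max/0]_(i <- r) F i) (\big[Num.max/0]_(i <- s) F i).
Proof.
elim: r => [|i r IH]; first by rewrite big_nil max_r// bigmax0_ge0.
by rewrite cat_cons !big_cons IH maxA.
Qed.

(** A balanced tree: the list is halved at each level, and a leaf reached early is delayed by the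
    remaining layers. *)
Lemma sum_rep_bigmax (I : Type) (u : I -> 'cV_d -> R) (t : nat) (r : seq I) :
  (forall i, reach c 0 1 2 (fun x => const_mx (Num.max 0 (u i x)) : 'cV_1)) ->
  (0 < size r <= 2 ^ t)%N ->
  exists q, sum_rep t (size r) q
    (fun x => 2^-1 ^+ t * \big[Num.max/0]_(i <- r) u i x).
Proof.
move=> hu; elim: t r => [|t IH] r.
  case: r => [|i [|]]//= _; exists 1%N, 2%N.
  exists (fun x => const_mx (Num.max 0 (u i x))); split=> //.
    by apply: reach_le (hu i).
  by move=> x; rewrite big_ord1 mxE expr0 mul1r big_cons big_nil maxC.
have [le1|gt1] := leqP (size r) 1.
  case: r le1 => [|i [|]]//= _ _; exists 1%N, (2 + t.+1)%N.
  exists (fun x => const_mx (2^-1 ^+ t.+1 * Num.max 0 (u i x))); split=> //.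
  - have u0 x : 0 <= Num.max 0 (u i x) by rewrite le_max lexx.
    have := reach_delay t.+1 u0 (hu i) (ltnSn 0).
    exact: reach_le.
  - have : (t.+1 < 2 ^ t.+1)%N by rewrite ltn_expl.
    by have := expnS 2 t.+1; rewrite /=; lia.
  - by move=> x; rewrite big_ord1 mxE big_cons big_nil maxC.
move=> /andP[_ hr].
have [r1 [r2 [er sz1 sz2]]] : exists r1 r2,
    [/\ r = r1 ++ r2, (0 < size r1 <= 2 ^ t)%N & (0 < size r2 <= 2 ^ t)%N].
  exists (take (size r)./2 r), (drop (size r)./2 r).
  have le2 : ((size r)./2 <= size r)%N by lia.
  rewrite cat_take_drop size_takel// size_drop; move: hr; rewrite expnS => hr.
  by split=> //; lia.
have [q1 h1] := IH r1 sz1; have [q2 h2] := IH r2 sz2.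
have pos (s : seq I) (x : 'cV_d) : 0 <= 2^-1 ^+ t * \big[Num.max/0]_(i <- s) u i x.
  by rewrite mulr_ge0 ?exprn_ge0// bigmax0_ge0.
have mx x : 2^-1 ^+ t.+1 * \big[Num.max/0]_(i <- r) u i x = 2^-1 *
    Num.max (2^-1 ^+ t * \big[Num.max/0]_(i <- r1) u i x)
            (2^-1 ^+ t * \big[Num.max/0]_(i <- r2) u i x).
  by rewrite er bigmax0_cat exprS -mulrA maxr_pMr// exprn_ge0.
exists 2%N; rewrite (funext mx) er size_cat.
have [q21|/ltnW q12] := leqP q2 q1.
  by apply: (sum_rep_max _ q21 (pos _) h1 h2); case/andP: sz1.
under eq_fun do rewrite maxC.
by rewrite addnC; apply: (sum_rep_max _ q12 (pos _) h2 h1); case/andP: sz2.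
Qed.

(** The factor [s] enters in the first layer, the only hidden one with entries up to [c]; hence the
    bounds on [s], [s * h] and [s * |z i|]. One last neuron combines the delayed constant with the
    two trees of maxima. *)
Lemma reach_hat (t : nat) (s h : R) (z : 'I_d -> R) : (1 < d)%N ->
  (d <= 2 ^ t <= 2 * d.-1)%N -> 0 <= s -> 0 <= h -> s * h <= c -> s <= c ->
  (forall i, s * `|z i| <= c) ->
  reach c t.+1 (4 * d + 1) (15 * d + t - 9) (fun x => const_mx (2^-1 ^+ t.+1 *
    (s * Num.max 0 (h - \big[Num.max/0]_i (x i 0 - z i)
                      - \big[Num.max/0]_i (z i - x i 0)))) : 'cV_1).
Proof.
move=> d1 /andP[dt td] s0 h0 shc sc szc.
have hr : (0 < size (index_enum 'I_d) <= 2 ^ t)%N.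
  by rewrite /index_enum -enumT size_enum_ord; lia.
have hp : forall i, reach c 0 1 2 (fun x : 'cV_d =>
    const_mx (Num.max 0 (s * x i 0 + - (s * z i))) : 'cV_1).
  move=> i; apply: reach_affine; rewrite ?normrN ?normrM ?(ger0_norm s0)//.
have hn : forall i, reach c 0 1 2 (fun x : 'cV_d =>
    const_mx (Num.max 0 (- s * x i 0 + s * z i)) : 'cV_1).
  move=> i; apply: reach_affine; rewrite ?normrN ?normrM ?(ger0_norm s0)//.
have [p [Np [P [hP hp2 hNp sP]]]] := sum_rep_bigmax hp hr.
have [q [Nq [Q [hQ hq2 hNq sQ]]]] := sum_rep_bigmax hn hr.
have szd : size (index_enum 'I_d) = d by rewrite /index_enum -enumT size_enum_ord.
rewrite szd in hP hQ hNp hNq.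
have hsh : 0 <= s * h <= c by rewrite shc mulr_ge0.
have hK : reach c t 1 (1 + t) (fun x : 'cV_d => const_mx (2^-1 ^+ t * (s * h)) : 'cV_1).
  by apply: reach_delay => //; [case/andP: hsh|apply: reach_const].
pose A : 'M[R]_(1, 1 + (p + q)) :=
  row_mx (const_mx 2^-1) (row_mx (const_mx (- 2^-1)) (const_mx (- 2^-1))).
have hA : half_entries A.
  by apply: half_entries_row_mx; last apply: half_entries_row_mx;
    apply: half_entries_const; rewrite ?half_memP ?half_memN.
have nA : (nnz A <= 1 + p + q)%N.
  rewrite !nnz_row_mx.
  have := nnz_le (const_mx 2^-1 : 'M[R]_(1, 1)).
  have := nnz_le (const_mx (- 2^-1) : 'M[R]_(1, p)).
  have := nnz_le (const_mx (- 2^-1) : 'M[R]_(1, q)).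
  lia.
have hw : (1 <= 1 + (2 * d + 2 * d))%N by [].
have := reach_step (reach_col_mx hK (reach_col_mx hP hQ)) hA hw.
move=> /(reach_le (_ : _ <= 4 * d + 1)%N (_ : _ <= 15 * d + t - 9)%N) hR.
apply: reach_ext (hR _ _); last 2 first.
- lia.
(* As 2^(t+1) <= 4 d - 4, the trees use at most 15 d - 16 parameters plus their surplus; the
   constant adds 1 + t and the last neuron 1 + p + q. The total is largest for p = q = 1. *)
- have := expnS 2 t; case: eqP hNp; case: eqP hNq => /=; lia.
move=> x; rewrite !mul_row_col !mul_const_mx; apply/matrixP => i j.
rewrite !mxE big_ord1 mxE sP sQ.
have bigM (F : 'I_d -> R) :
    s * \big[Num.max/0]_i F i = \big[Num.max/0]_i (s * F i).
  by apply: (big_morph ( *%R s)) => [y y'|]; rewrite ?mulr0// maxr_pMr.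
rewrite exprS -mulrA !maxr_pMr ?exprn_ge0// !mulr0.
congr Num.max; rewrite !mulrBr !bigM.
have -> : \big[Num.max/0]_i (s * (x i 0 - z i)) =
    \big[Num.max/0]_i (s * x i 0 + - (s * z i)).
  by apply: eq_bigr => k _; rewrite mulrBr.
have -> : \big[Num.max/0]_i (s * (z i - x i 0)) =
    \big[Num.max/0]_i (- s * x i 0 + s * z i).
  by apply: eq_bigr => k _; rewrite mulrBr mulNr addrC.
by ring.
Qed.

(** The nodes of each sign are gathered in one neuron, which is copied [m] times and summed with
    weight [a] or [- a]. Gathering and copying each halve, whence m a / 4; all values are
    nonnegative, so relu leaves them unchanged. *)
Lemma mlp_amplify (T : finType) (t w N m : nat) (g : T -> 'cV_d -> R)
    (sgn : T -> bool) (a b : R) :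
  (forall k, reach c t w N (fun x => const_mx (g k x) : 'cV_1)) ->
  (forall k x, 0 <= g k x) -> (0 < m)%N -> 0 <= a <= c -> `|b| <= c ->
  exists Phi : mlp R 1 d,
    [/\ mlp_depth Phi = (t + 3)%N,
        (mlp_width Phi <= maxn (#|T| * w) (2 * m))%N,
        (mlp_nnz Phi <= #|T| * N.+1 + 4 * m + (b != 0%R))%N, admissible c Phi
      & forall x, mlp_fun Phi x =
          m%:R * a / 4 * \sum_k (if sgn k then g k x else - g k x) + b].
Proof.
move=> hg g0 m0 /andP[a0 ac] bc.
pose W := maxn (#|T| * w) (2 * m).
pose v x : 'cV[R]_#|T| := \col_i g (enum_val i) x.
have hG : reach c t W (#|T| * N) v.
  have := reach_col (fun i : 'I_#|T| => hg (enum_val i)).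
  exact: reach_le (leq_maxl _ (2 * m)) (leqnn _).
pose half (p : pred T) : 'rV[R]_#|T| := \row_i if p (enum_val i) then 2^-1 else 0.
pose A : 'M[R]_(1 + 1, #|T|) := col_mx (half sgn) (half (predC sgn)).
have hA : half_entries A.
  by apply: half_entries_col_mx => i j; rewrite mxE; case: ifP => _;
    rewrite ?half_mem0 ?half_memP.
have nA : nnz A = #|T|.
  rewrite nnz_col_mx /nnz !big_ord1 -big_split/=.
  transitivity (\sum_(i < #|T|) 1)%N; last by rewrite sum1_card card_ord.
  apply: eq_bigr => i _; rewrite !mxE /=.
  by case: (sgn _); rewrite /= eqxx ?invr_eq0 pnatr_eq0.
have hW : (1 + 1 <= W)%N by rewrite /W; lia.
have {}hG := reach_step hG hA hW.
pose B : 'M[R]_(m + m, 1 + 1) := block_mx (const_mx 2^-1) 0 0 (const_mx 2^-1).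
have hB : half_entries B.
  by apply: half_entries_col_mx; apply: half_entries_row_mx;
    apply: half_entries_const; rewrite ?half_mem0 ?half_memP.
have nB : (nnz B <= 2 * m)%N.
  rewrite nnz_block_mx !nnz0.
  by have := nnz_le (const_mx 2^-1 : 'M[R]_(m, 1)); lia.
have hW' : (m + m <= W)%N by rewrite /W; lia.
have {}hG := reach_step hG hB hW'.
pose Z : 'M[R]_(1, m + m) := row_mx (const_mx a) (const_mx (- a)).
have hZ : entries_le c Z.
  by apply: entries_le_row_mx; apply: entries_le_const; rewrite ?normrN ger0_norm.
have nZ : (nnz Z <= 2 * m)%N by apply: leq_trans (nnz_le _) _; lia.
have nb : nnz (const_mx b : 'cV[R]_1) = (b != 0).
  by rewrite /nnz !big_ord1 mxE.
have [|Phi [h1 h2 h3 h4 h5]] := @reach_mlp _ _ _ 1 _ _ _ _ _ (Output Z (const_mx b)) hG.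
  by split=> //; exact: entries_le_const.
exists Phi; split=> //.
- by rewrite h1 /=; lia.
- by move: h3; rewrite nA /= nb; lia.
move=> x; rewrite /mlp_fun h5 /= mxE [const_mx b _ _]mxE; congr (_ + _).
have gather (p : pred T) : relu (half p *m v x) =
    const_mx (2^-1 * \sum_(k | p k) g k x).
  apply/matrixP => i j; rewrite !mxE max_r.
    rewrite [in RHS]big_mkcond [in RHS]big_enum_val mulr_sumr.
    by apply: eq_bigr => k _; rewrite !mxE; case: ifP => _; rewrite ?mulr0 ?mul0r.
  by apply: sumr_ge0 => k _; rewrite !mxE; case: ifP => _; rewrite mulr_ge0.
have -> : A *m v x = col_mx (half sgn *m v x) (half (predC sgn) *m v x).
  exact: mul_col_mx.
rewrite relu_col_mx !gather.
have -> : \sum_k (if sgn k then g k x else - g k x) =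
    \sum_(k | sgn k) g k x - \sum_(k | predC sgn k) g k x.
  rewrite (bigID sgn)/= -sumrN; congr (_ + _); apply: eq_bigr => k.
    by move=> ->.
  by move=> /negbTE ->.
have Sp : 0 <= \sum_(k | sgn k) g k x by apply: sumr_ge0.
have Sn : 0 <= \sum_(k | predC sgn k) g k x by apply: sumr_ge0.
have -> : B *m col_mx (const_mx (2^-1 * \sum_(k | sgn k) g k x))
    (const_mx (2^-1 * \sum_(k | predC sgn k) g k x)) =
    col_mx (const_mx (2^-1 * (2^-1 * \sum_(k | sgn k) g k x)))
           (const_mx (2^-1 * (2^-1 * \sum_(k | predC sgn k) g k x))) :> 'cV[R]_(m + m).
  by rewrite mul_block_col !mul0mx addr0 add0r !mul_const_const_mx !mul1r.
rewrite relu_col_mx !relu_const_mx !max_r ?mulr_ge0// mul_row_col.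
by rewrite !mul_const_const_mx !mxE; field.
Qed.

End Blocks.

(** * Interpolation on the Kuhn triangulation *)

Section Sampling.
Variable R : realType.

(** Replaces integrals over [0,1) by finite sums: the nodes are the left ends of the intervals cut
    out by 0, 1 and the points of [B], the weights their lengths. The indicator of [0,b) is summed
    exactly because the lengths up to b telescope. *)
Lemma step_quadrature (B : seq R) : {in B, forall b, 0 <= b <= 1} ->
  exists m (w tau : 'I_m -> R),
    [/\ forall j, 0 <= w j, forall j, 0 <= tau j < 1, \sum_j w j = 1
      & {in B, forall b, \sum_j w j * (tau j < b)%R%:R = b}].
Proof.
move=> hB; pose s := sort <=%O (undup (0 :: 1 :: B)).
have ss : sorted <%O s by rewrite sort_lt_sorted undup_uniq.
have ms b : (b \in s) = (b \in 0 :: 1 :: B) by rewrite mem_sort mem_undup.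
have s01 b : b \in s -> 0 <= b <= 1.
  by rewrite ms !inE => /or3P[/eqP->|/eqP->|/hB//]; rewrite ?lexx ?ler01.
have s0 : 0 \in s by rewrite ms inE eqxx.
have s1 : 1 \in s by rewrite ms !inE eqxx orbT.
have lt_nth i j : (i < size s)%N -> (j < size s)%N ->
    (nth 0 s i < nth 0 s j) = (i < j)%N.
  by move=> si sj; apply: (lt_sorted_ltn_nth 0 ss); rewrite inE.
have sgt0 : (0 < size s)%N by case: (s) s0.
have nth0s : nth 0 s 0 = 0.
  apply/le_anti; have /s01/andP[-> _] := mem_nth 0 sgt0; rewrite andbT.
  rewrite -{2}(nth_index 0 s0) (lt_sorted_leq_nth 0 ss)// inE ?index_mem//.
have key b : b \in s -> \sum_(j < (size s).-1)
    (nth 0 s j.+1 - nth 0 s j) * (nth 0 s j < b)%R%:R = b.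
  move=> bs; rewrite -(big_mkord xpredT (fun j =>
    (nth 0 s j.+1 - nth 0 s j) * (nth 0 s j < b)%R%:R)).
  have bi : (index b s < size s)%N by rewrite index_mem.
  rewrite (@big_cat_nat _ _ _ (index b s))//=; last by rewrite -ltnS prednK.
  rewrite [X in _ + X](_ : _ = 0) ?addr0; last first.
    rewrite big_nat big1// => i /andP[bi' ilt].
    rewrite -{1}(nth_index 0 bs) lt_nth ?(leq_trans ilt (leq_pred _))//.
    by rewrite ltnNge bi' mulr0.
  rewrite big_nat (eq_bigr (fun j => nth 0 s j.+1 - nth 0 s j)).
    by rewrite -big_nat telescope_sumr// nth_index// nth0s subr0.
  move=> i /andP[_ ib]; rewrite -{1}(nth_index 0 bs) lt_nth ?(ltn_trans ib bi)//.
  by rewrite ib mulr1.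
exists (size s).-1, (fun j => nth 0 s j.+1 - nth 0 s j), (fun j => nth 0 s j).
have lt1 (j : 'I_(size s).-1) : 0 <= nth 0 s j < 1.
  have j1 : (j.+1 < size s)%N by have := ltn_ord j; lia.
  have /s01/andP[-> _] := mem_nth 0 (ltnW j1).
  by have /s01/andP[_] := mem_nth 0 j1; apply: lt_le_trans; rewrite lt_nth// ltnW.
split=> //.
- move=> j; have := ltn_ord j => hj; rewrite subr_ge0 ltW// lt_nth//; lia.
- rewrite -[RHS](key _ s1); apply: eq_bigr => j _.
  by have /andP[_ ->] := lt1 j; rewrite mulr1.
- by move=> b bB; apply: key; rewrite ms !inE bB !orbT.
Qed.

(** With th the fractional part of u, floor(u + tau) jumps from floor(u) to floor(u) + 1 at tau = 1
    - th. *)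
Lemma floor_shift (u tau : R) : 0 <= tau < 1 ->
  (Num.floor (u + tau))%:~R =
  (Num.floor u)%:~R + 1 - (tau < 1 - (u - (Num.floor u)%:~R))%R%:R :> R.
Proof.
move=> /andP[t0 t1]; have /andP[] := floor_itv u; rewrite intrD => h1 h2.
have [h|h] := ltrP; rewrite /= ?addrK ?subr0.
  by congr _%:~R; apply: floor_def; rewrite intrD; apply/andP; split; lra.
rewrite -[1]/(1%:~R) -intrD; congr _%:~R; apply: floor_def.
by rewrite !intrD; apply/andP; split; lra.
Qed.

(** Jensen's inequality, from the tangent of y^alpha at y = 1 applied to the ratios of the [s j] to
    their mean. *)
Lemma sum_powR_le (m : nat) (w s : 'I_m -> R) (alpha : R) : 0 < alpha <= 1 ->
  (forall j, 0 <= w j) -> \sum_j w j = 1 -> (forall j, 0 <= s j) ->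
  \sum_j w j * s j `^ alpha <= (\sum_j w j * s j) `^ alpha.
Proof.
move=> /andP[a0 a1] w0 w1 s0.
(* Young's inequality for y^alpha and 1 with exponents 1/alpha and 1/(1 - alpha); for alpha = 1 the
   second would be infinite. *)
have tangent (y : R) : 0 <= y -> y `^ alpha <= alpha * y + (1 - alpha).
  move=> y0; have [->|na1] := eqVneq alpha 1; first by rewrite powRr1//; lra.
  have a1' : 0 < 1 - alpha by rewrite subr_gt0 lt_neqAle na1.
  have := @conjugate_powR R (y `^ alpha) 1 alpha^-1 (1 - alpha)^-1
    (powR_ge0 _ _) ler01.
  rewrite !invr_gt0 !invrK powR1 -powRrM divff ?gt_eqF// powRr1// mulr1 mul1r.
  have e : alpha + (1 - alpha) = 1 by ring.
  by move=> /(_ a0 a1' e); rewrite mulrC.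
set S := \sum_j w j * s j.
have S0 : 0 <= S by apply: sumr_ge0 => j _; rewrite mulr_ge0.
(* With mean zero the ratios make no sense, but then [w j] or [s j] vanishes for every j. *)
have [S00|Sn0] := eqVneq S 0.
  rewrite [leLHS]big1 ?powR_ge0// => j _.
  have /eqP : w j * s j = 0.
    by apply/eqP; move/eqP: S00; rewrite psumr_eq0 => [/allP/(_ j)|i _];
      [apply; rewrite mem_index_enum|rewrite mulr_ge0].
  rewrite mulf_eq0 => /orP[/eqP->|/eqP->]; first by rewrite mul0r.
  by rewrite powR0 ?mulr0// gt_eqF.
have Sp : 0 < S by rewrite lt_neqAle eq_sym Sn0.
have -> : S `^ alpha = \sum_j w j * (S `^ alpha * (alpha * (s j / S) + (1 - alpha))).
  under eq_bigr do rewrite mulrCA.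
  rewrite -mulr_sumr -[LHS]mulr1; congr (_ * _).
  under eq_bigr do rewrite mulrDr.
  rewrite big_split/= -mulr_suml w1 mul1r.
  have -> : \sum_j w j * (alpha * (s j / S)) = alpha.
    transitivity (alpha / S * (\sum_j w j * s j)); last by rewrite -/S divfK.
    by rewrite mulr_sumr; apply: eq_bigr => j _; ring.
  by rewrite addrC subrK.
apply: ler_sum => j _; apply: ler_wpM2l => //.
rewrite -[s j in leLHS](divfK Sn0) mulrC powRM ?divr_ge0//.
by apply: ler_wpM2l; rewrite ?powR_ge0// tangent// divr_ge0.
Qed.

Variables (d g : nat).

Definition hat (u k : 'I_d -> R) : R :=
  Num.max 0 (1 - \big[Num.max/0]_i (u i - k i) - \big[Num.max/0]_i (k i - u i)).

(* The grid index floor(u + tau); as tau runs through [0,1) it runs through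
   the vertices of the simplex of the Kuhn triangulation containing u. *)
Definition shifted_floor (u : 'I_d -> R) (tau : R) : {ffun 'I_d -> 'I_g.+1} :=
  [ffun i => inord `|Num.floor (u i + tau)|%N].

(** u_i + tau lies in [0, g + 1), so neither the absolute value nor [inord] alters the floor. *)
Lemma shifted_floorE (u : 'I_d -> R) (tau : R) (i : 'I_d) :
  0 <= u i <= g%:R -> 0 <= tau < 1 ->
  (shifted_floor u tau i)%:R = (Num.floor (u i + tau))%:~R :> R.
Proof.
move=> /andP[u0 ug] /andP[t0 t1]; rewrite ffunE.
have f0 : 0 <= Num.floor (u i + tau) by rewrite floor_ge0 addr_ge0.
have fg : Num.floor (u i + tau) < (g.+1)%:Z.
  by rewrite floor_lt_int -pmulrn -natr1; lra.
rewrite inordK; last by lia.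
by rewrite -[in RHS](gez0_abs f0) -pmulrn.
Qed.

(** Coordinate i requires k_i - u_i <= tau < 1 - (u_i - k_i); intersecting over i gives one
    interval. The initial 0 of the maxima is harmless because tau is in [0,1). *)
Lemma shifted_floor_eq (u : 'I_d -> R) (tau : R) (k : {ffun 'I_d -> 'I_g.+1}) :
  (forall i, 0 <= u i <= g%:R) -> 0 <= tau < 1 ->
  (shifted_floor u tau == k) =
  (\big[Num.max/0]_i ((k i)%:R - u i) <= tau) &&
  (tau < 1 - \big[Num.max/0]_i (u i - (k i)%:R)).
Proof.
move=> hu ht; have /andP[t0 t1] := ht.
have -> : (tau < 1 - \big[Num.max/0]_i (u i - (k i)%:R)) =
          (\big[Num.max/0]_i (u i - (k i)%:R) < 1 - tau).
  by rewrite ltrBrDr addrC -ltrBrDr.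
apply/eqP/andP => [<-|[/bigmax_leP[_ h1] /bigmax_ltP[_ h2]]].
  split; [apply/bigmax_leP|apply/bigmax_ltP]; split; rewrite ?subr_gt0// => i _;
    rewrite shifted_floorE//; have /andP[] := floor_itv (u i + tau);
    rewrite intrD; lra.
apply/ffunP => i; apply/val_inj/eqP; rewrite -(eqr_nat R) shifted_floorE//.
rewrite pmulrn eqr_int; apply/eqP/floor_def; rewrite intrD -pmulrn.
have := h1 i isT; have := h2 i isT => ? ?; apply/andP; split; lra.
Qed.

(* A quadrature rule integrating exactly the step functions of tau attached to u. *)
Definition samples (u : 'I_d -> R) (m : nat) (w tau : 'I_m -> R) : Prop :=
  [/\ forall F : {ffun 'I_d -> 'I_g.+1} -> R,
        \sum_k F k * hat u (fun i => (k i)%:R) =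
        \sum_j w j * F (shifted_floor u (tau j)),
      forall i, \sum_j w j * (shifted_floor u (tau j) i)%:R = u i
    & forall i, \sum_j w j * `|u i - (shifted_floor u (tau j) i)%:R| <= 2^-1].

(** The jump of floor(u_i + tau) for each i, and the two ends, clipped to [0,1], of the interval of
    those tau that select the node k. *)
Definition breakpoints (u : 'I_d -> R) : seq R :=
  [seq 1 - (u i - (Num.floor (u i))%:~R) | i : 'I_d] ++
  [seq Num.min 1 (\big[Num.max/0]_i ((k i)%:R - u i)) |
     k : {ffun 'I_d -> 'I_g.+1}] ++
  [seq Num.max 0 (1 - \big[Num.max/0]_i (u i - (k i)%:R)) |
     k : {ffun 'I_d -> 'I_g.+1}].

Lemma breakpoints01 (u : 'I_d -> R) :
  {in breakpoints u, forall b, 0 <= b <= 1}.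
Proof.
move=> b; rewrite !mem_cat => /or3P[] /mapP[k _ ->].
- by have /andP[] := floor_itv (u k); rewrite intrD => *; apply/andP; split; lra.
- by rewrite le_min ler01 ge_min lexx bigmax_ge_id.
- rewrite le_max lexx ge_max ler01/= lerBlDr lerDl; exact: bigmax_ge_id.
Qed.

Lemma breakpoints_samples (u : 'I_d -> R) (m : nat) (w tau : 'I_m -> R) :
  (forall i, 0 <= u i <= g%:R) -> (forall j, 0 <= w j) ->
  (forall j, 0 <= tau j < 1) -> \sum_j w j = 1 ->
  {in breakpoints u, forall b, \sum_j w j * (tau j < b)%R%:R = b} ->
  samples u w tau.
Proof.
move=> hu w0 ht w1 hB.
have hfl i : \sum_j w j * (tau j < 1 - (u i - (Num.floor (u i))%:~R))%R%:R =
    1 - (u i - (Num.floor (u i))%:~R).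
  apply: hB; rewrite mem_cat; apply/orP; left.
  by apply/mapP; exists i; rewrite ?mem_enum.
split.
- move=> F.
  (* The hat is the total weight of the samples that select the node k. *)
  have key (k : {ffun 'I_d -> 'I_g.+1}) : hat u (fun i => (k i)%:R) =
      \sum_j w j * (shifted_floor u (tau j) == k)%:R.
    set P := \big[Num.max/0]_i (u i - (k i)%:R).
    set Q := \big[Num.max/0]_i ((k i)%:R - u i).
    have P0 : 0 <= P by exact: bigmax_ge_id.
    have Q0 : 0 <= Q by exact: bigmax_ge_id.
    have hlo : \sum_j w j * (tau j < Num.min 1 Q)%R%:R = Num.min 1 Q.
      apply: hB; rewrite !mem_cat; apply/orP; right; apply/orP; left.
      by apply/mapP; exists k; rewrite ?mem_enum.
    have hhi : \sum_j w j * (tau j < Num.max 0 (1 - P))%R%:R = Num.max 0 (1 - P).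
      apply: hB; rewrite !mem_cat; apply/orP; right; apply/orP; right.
      by apply/mapP; exists k; rewrite ?mem_enum.
    have ind j : (shifted_floor u (tau j) == k) =
        (Num.min 1 Q <= tau j < Num.max 0 (1 - P)).
      rewrite shifted_floor_eq// -/P -/Q.
      have /andP[t0 t1] := ht j.
      by rewrite ge_min lt_max [1 <= _]leNgt t1 [tau j < 0]ltNge t0.
    transitivity (Num.max 0 (Num.max 0 (1 - P) - Num.min 1 Q)).
      rewrite /hat -/P -/Q.
      have [p|p] := leP 0 (1 - P); have [q|q] := leP 1 Q;
        have [r|r] := leP 0 (1 - P - Q); rewrite /Num.max; do ?case: ifP => ?; lra.
    have [lh|hl] := leP (Num.min 1 Q) (Num.max 0 (1 - P)).
      rewrite max_r ?subr_ge0// -{1}hlo -{1}hhi -sumrB; apply: eq_bigr => j _.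
      rewrite ind -mulrBr; congr (_ * _); case: (leP (Num.min 1 Q)) => h1 /=.
        by rewrite subr0.
      by rewrite (lt_le_trans h1 lh) subrr.
    rewrite max_l ?subr_le0 1?ltW// big1// => j _; rewrite ind.
    case: (leP (Num.min 1 Q)) => h1 /=; last by rewrite mulr0.
    by rewrite ltNge (le_trans (ltW hl) h1) mulr0.
  under eq_bigr do rewrite key mulr_sumr.
  rewrite exchange_big; apply: eq_bigr => j _.
  rewrite (bigD1 (shifted_floor u (tau j)))//= eqxx mulr1 mulrC big1 ?addr0//.
  by move=> k; rewrite eq_sym => /negbTE ->; rewrite !mulr0.
- move=> i; under eq_bigr do rewrite shifted_floorE// floor_shift//.
  under eq_bigr do rewrite mulrBr.
  by rewrite sumrB hfl -mulr_suml w1; ring.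
- move=> i; under eq_bigr do rewrite shifted_floorE// floor_shift//.
  have /andP[] := floor_itv (u i); rewrite intrD.
  set t := u i - _ in hfl *; set a := (Num.floor (u i))%:~R => h1 h2.
  have ua : u i = a + t by rewrite /t -/a; ring.
  (* The distance is t when tau < 1 - t and 1 - t otherwise, so its average is 2 t (1 - t) <=
     1/2. *)
  have -> : \sum_j w j * `|u i - (a + 1 - (tau j < 1 - t)%R%:R)| =
      \sum_j (w j * (tau j < 1 - t)%R%:R * (2 * t - 1) + w j * (1 - t)).
    apply: eq_bigr => j _; case: ltP => _ /=.
      by rewrite ger0_norm ua; [ring|lra].
    by rewrite ler0_norm ua; [ring|lra].
  rewrite big_split/= -!mulr_suml hfl w1.
  have := sqr_ge0 (t - 2^-1); nra.
Qed.

(** One rule serves both points, so that their interpolants can be compared at the same tau. *)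
Lemma exists_samples (u v : 'I_d -> R) :
  (forall i, 0 <= u i <= g%:R) -> (forall i, 0 <= v i <= g%:R) ->
  exists m (w tau : 'I_m -> R),
    [/\ forall j, 0 <= w j, forall j, 0 <= tau j < 1, \sum_j w j = 1,
        samples u w tau & samples v w tau].
Proof.
move=> hu hv.
have [|m [w [tau [w0 ht w1 hB]]]] := @step_quadrature (breakpoints u ++ breakpoints v).
  by move=> b; rewrite mem_cat => /orP[]; apply: breakpoints01.
exists m, w, tau; split=> //; apply: breakpoints_samples => // b hb;
  by apply: hB; rewrite mem_cat hb ?orbT.
Qed.

End Sampling.

(** * Hölder continuity and error of the interpolant *)

Section Interpolation.
Variables (R : realType) (d g : nat) (alpha L : R) (f : 'cV[R]_d -> R).
Hypotheses (halpha : 0 < alpha <= 1) (hL : 0 <= L) (hg : (0 < g)%N).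
Hypothesis hf : holder_on (@unit_cube R d) L alpha f.

Definition grid_point (k : {ffun 'I_d -> 'I_g.+1}) : 'cV[R]_d :=
  \col_i ((k i)%:R / g%:R).

Definition interpolation (x : 'cV[R]_d) : R :=
  \sum_k f (grid_point k) * hat (fun i => g%:R * x i 0) (fun i => (k i)%:R).

Lemma grid_point_cube (k : {ffun 'I_d -> 'I_g.+1}) : unit_cube (grid_point k).
Proof.
move=> i; rewrite mxE divr_ge0//= ler_pdivrMr ?ltr0n// mul1r ler_nat.
by rewrite -ltnS ltn_ord.
Qed.

Lemma scaled_cube (x : 'cV[R]_d) : unit_cube x ->
  forall i, 0 <= g%:R * x i 0 <= g%:R.
Proof.
by move=> hx i; have /andP[x0 x1] := hx i; rewrite mulr_ge0//= ler_piMr.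
Qed.

(** The averages are coupled through the common index j: the Hölder bound applies term by term, then
    Jensen. *)
Lemma holder_average (m : nat) (w : 'I_m -> R) (p q : 'I_m -> 'cV[R]_d) :
  (forall j, 0 <= w j) -> \sum_j w j = 1 ->
  (forall j, unit_cube (p j)) -> (forall j, unit_cube (q j)) ->
  `|\sum_j w j * f (p j) - \sum_j w j * f (q j)| <=
  L * (\sum_i \sum_j w j * `|p j i 0 - q j i 0|) `^ alpha.
Proof.
move=> w0 w1 hp hq; rewrite -sumrB.
apply: le_trans (ler_norm_sum _ _ _) _.
apply: (@le_trans _ _ (L * \sum_j w j * norm1 (p j - q j) `^ alpha)).
  rewrite mulr_sumr; apply: ler_sum => j _.
  rewrite -mulrBr normrM ger0_norm// mulrCA; apply: ler_wpM2l => //; exact: hf.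
apply: ler_wpM2l => //.
apply: le_trans (sum_powR_le halpha w0 w1 _) _; first by move=> j; apply: sumr_ge0.
rewrite exchange_big/= le_eqVlt; apply/orP; left; apply/eqP; congr (_ `^ _).
by apply: eq_bigr => j _; rewrite mulr_sumr; apply: eq_bigr => i _; rewrite !mxE.
Qed.

Lemma interpolation_holder : holder_on (@unit_cube R d) L alpha interpolation.
Proof.
move=> x y hx hy.
have hu := scaled_cube hx; have hv := scaled_cube hy.
have [m [w [tau [w0 ht w1 [Fu mu _] [Fv mv _]]]]] := exists_samples hu hv.
rewrite /interpolation Fu Fv.
apply: le_trans (holder_average w0 w1 _ _) _ => [j|j|]; try exact: grid_point_cube.
rewrite le_eqVlt; apply/orP; left; apply/eqP; congr (_ * _ `^ _).
apply: eq_bigr => i _; rewrite !mxE.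
have g0 : 0 < g%:R^-1 :> R by rewrite invr_gt0 ltr0n.
under eq_bigr do rewrite !mxE -mulrBl normrM (gtr0_norm g0) mulrA.
rewrite -mulr_suml.
(* By monotonicity of the floor, the index differences have the same sign for all tau, so their
   absolute values average to the difference of the means. *)
have mono (u v : 'I_d -> R) : (forall i, 0 <= u i <= g%:R) ->
    (forall i, 0 <= v i <= g%:R) ->
    (forall i, \sum_j w j * (shifted_floor g u (tau j) i)%:R = u i) ->
    (forall i, \sum_j w j * (shifted_floor g v (tau j) i)%:R = v i) ->
    u i <= v i -> \sum_j w j * `|(shifted_floor g u (tau j) i)%:R -
      (shifted_floor g v (tau j) i)%:R| = v i - u i.
  move=> {}hu {}hv {}mu {}mv uv; rewrite -[in RHS]mu -[in RHS]mv -sumrB.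
  apply: eq_bigr => j _; rewrite -mulrBr distrC ger0_norm// subr_ge0.
  by rewrite !shifted_floorE// ler_int le_floor// lerD2r.
have gn0 : g%:R != 0 :> R by rewrite pnatr_eq0 -lt0n.
have [xy|/ltW yx] := leP (x i 0) (y i 0).
  rewrite mono//; last by apply: ler_wpM2l.
  by rewrite -mulrBr mulrC mulKf// distrC ger0_norm ?subr_ge0.
under eq_bigr do rewrite distrC.
rewrite mono//; last by apply: ler_wpM2l.
by rewrite -mulrBr mulrC mulKf// ger0_norm ?subr_ge0.
Qed.

Lemma interpolation_error (x : 'cV[R]_d) : unit_cube x ->
  `|f x - interpolation x| <= L * (d%:R / (2 * g%:R)) `^ alpha.
Proof.
move=> hx; have hu := scaled_cube hx.
have [m [w [tau [w0 ht w1 [Fu _ eu] _]]]] := exists_samples hu hu.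
rewrite /interpolation Fu.
(* f x is the average of a constant, so [holder_average] compares x itself with the sampled
   vertices. *)
have -> : f x = \sum_j w j * f x by rewrite -mulr_suml w1 mul1r.
apply: le_trans (holder_average w0 w1 _ _) _ => [j|j|]; try exact: grid_point_cube.
  exact: hx.
have g0 : 0 < g%:R^-1 :> R by rewrite invr_gt0 ltr0n.
have gn0 : g%:R != 0 :> R by rewrite pnatr_eq0 -lt0n.
apply: ler_wpM2l => //; apply: ge0_ler_powR; rewrite ?nnegrE.
- by case/andP: halpha => /ltW.
- by apply: sumr_ge0 => i _; apply: sumr_ge0 => j _; rewrite mulr_ge0.
- by rewrite divr_ge0// mulr_ge0.
have -> : d%:R / (2 * g%:R) = \sum_(i < d) 2^-1 / g%:R :> R.
  by rewrite sumr_const card_ord invfM mulr_natl.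
apply: ler_sum => i _; rewrite ler_pdivlMr ?ltr0n// mulr_suml.
apply: le_trans (eu i); apply: ler_sum => j _; rewrite mxE -mulrA.
apply: ler_wpM2l => //.
rewrite -[X in _ * X]normr_nat -normrM mulrBl divfK//.
by rewrite [x i 0 * _]mulrC.
Qed.

End Interpolation.

(** * Networks computing the interpolant *)

Section Construction.
Variable R : realType.

Lemma up_log_le_ceil (d : nat) : (0 < d)%N ->
  (up_log 2 d)%:Z <= Num.ceil (log2 (d%:R : R)).
Proof.
move=> d0; have [d1|d1] := leqP d 1.
  have -> : d = 1%N by lia.
  by rewrite up_log1 /log2 ln1 mul0r ceil0.
have := up_log_gtn (isT : 1 < 2)%N d1.
have : (0 < up_log 2 d)%N by rewrite up_log_gt0.
case: (up_log 2 d) => // t _ /= td.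
have -> : (t.+1%:Z <= Num.ceil (log2 (d%:R : R))) = (t%:Z < Num.ceil (log2 (d%:R : R))).
  by rewrite -lez1D.
rewrite ceil_gt_int /log2 ltr_pdivlMr; last by rewrite ln_gt0// ltr1n.
rewrite -pmulrn mulr_natl -lnXn// ltr_ln ?posrE ?exprn_gt0 ?ltr0n//.
by rewrite -natrX ltr_nat.
Qed.

(** Raising the hypothesis to the power alpha gives L n / d^(1 - alpha) <= (2 g)^alpha; it remains
    to split d = d^alpha d^(1 - alpha). *)
Lemma holder_grid_bound (d n g : nat) (alpha L : R) :
  (0 < d)%N -> (0 < n)%N -> (0 < g)%N -> 0 < alpha -> 0 <= L ->
  2^-1 * (L * n%:R / d%:R `^ (1 - alpha)) `^ alpha^-1 <= g%:R ->
  L * (d%:R / (2 * g%:R)) `^ alpha <= d%:R / n%:R.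
Proof.
move=> d0 n0 g0 a0 L0 hg.
have dR : 0 < d%:R :> R by rewrite ltr0n.
have nR : 0 < n%:R :> R by rewrite ltr0n.
have g2 : 0 < 2 * g%:R :> R by rewrite mulr_gt0// ltr0n.
set A := L * n%:R / d%:R `^ (1 - alpha) in hg.
have A0 : 0 <= A by rewrite divr_ge0 ?powR_ge0// mulr_ge0.
have hA : A <= (2 * g%:R) `^ alpha.
  have -> : A = (A `^ alpha^-1) `^ alpha by rewrite -powRrM mulVf ?gt_eqF// powRr1.
  by apply: ge0_ler_powR; rewrite ?nnegrE ?powR_ge0//; lra.
have d1a : 0 < d%:R `^ (1 - alpha) by rewrite powR_gt0.
have ga : 0 < (2 * g%:R) `^ alpha by rewrite powR_gt0.
have -> : (d%:R / (2 * g%:R)) `^ alpha = d%:R `^ alpha / (2 * g%:R) `^ alpha.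
  apply: (mulIf (lt0r_neq0 ga)); rewrite divfK ?gt_eqF// -powRM ?divr_ge0 ?ltW//.
  by rewrite divfK ?gt_eqF.
rewrite mulrA ler_pdivrMr// mulrAC ler_pdivlMr//.
have -> : d%:R * (2 * g%:R) `^ alpha =
    d%:R `^ alpha * (d%:R `^ (1 - alpha) * (2 * g%:R) `^ alpha).
  rewrite mulrA -powRD; last by apply/implyP => _; rewrite gt_eqF.
  by rewrite (_ : alpha + (1 - alpha) = 1) ?powRr1//; ring.
rewrite mulrAC mulrC; apply: ler_wpM2l; first exact: powR_ge0.
by rewrite -ler_pdivrMl// mulrC.
Qed.

(** In the unscaled variable x, 1/g and the node coordinates k_i/g are at most 1, so their products
    with |f(k/g)| fit in the first layer. *)
Lemma hat_scale (d : nat) (g : nat) (x : 'cV[R]_d) (k : 'I_d -> nat) : (0 < g)%N ->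
  hat (fun i => g%:R * x i 0) (fun i => (k i)%:R) = g%:R *
    Num.max 0 (g%:R^-1 - \big[Num.max/0]_i (x i 0 - (k i)%:R / g%:R)
                       - \big[Num.max/0]_i ((k i)%:R / g%:R - x i 0)).
Proof.
move=> g0; have gR : 0 < g%:R :> R by rewrite ltr0n.
have gn0 : g%:R != 0 :> R by rewrite gt_eqF.
have bigM (F : 'I_d -> R) :
    g%:R * \big[Num.max/0]_i F i = \big[Num.max/0]_i (g%:R * F i).
  by apply: (big_morph ( *%R g%:R)) => [y y'|]; rewrite ?mulr0// maxr_pMr.
rewrite maxr_pMr// mulr0 !mulrBr divff// !bigM.
congr (Num.max 0 (1 - _ - _)); apply: eq_bigr => i _;
  by rewrite mulrBr [g%:R * (_ / _)]mulrC divfK.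
Qed.

(** As t <= d - 1, each of the (g+1)^d nodes leaves at least 9 of its 16 d parameters. These pay for
    the 2^(t+4) g parameters of the amplification, since 2^t <= 2 (d - 1) and 4 (d - 1) g <=
    (g+1)^d. *)
Lemma node_count_bound (d t g : nat) : (1 < d)%N -> (2 ^ t <= 2 * d.-1)%N -> (0 < g)%N ->
  ((15 * d + t - 9).+1 * g.+1 ^ d + 4 * (2 ^ t.+2 * g) <= 16 * d * g.+1 ^ d)%N.
Proof.
case: d => [|[|e]]// _ te g0; rewrite /= in te.
have pow_le : (4 * e.+1 * g <= g.+1 ^ e.+2)%N.
  elim: e {te} => [|e IH]; first by rewrite expnS expn1; nia.
  by rewrite expnS; nia.
have te1 : (t <= e.+1)%N.
  rewrite -(leq_exp2l _ _ (isT : 1 < 2)%N); apply: leq_trans te _.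
  by rewrite expnS leq_mul2l/= ltn_expl.
have : (2 ^ t.+2 = 4 * 2 ^ t)%N by rewrite !expnS mulnA.
nia.
Qed.

Lemma interpolation_mlp (d n g : nat) (f : 'cV[R]_d -> R) :
  (1 < d)%N -> (1 < n)%N -> (0 < g)%N ->
  (forall x, unit_cube x -> - n%:R <= f x <= n%:R) ->
  exists Phi : mlp R 1 d,
    [/\ mlp_depth Phi = (up_log 2 d + 4)%N,
        (mlp_width Phi <= 8 * d * g.+1 ^ d)%N,
        (mlp_nnz Phi <= 16 * d * g.+1 ^ d)%N, admissible n%:R Phi
      & forall x, mlp_fun Phi x = interpolation g f x].
Proof.
move=> d1 n1 g0 hfn; set t := up_log 2 d.
have gR : 0 < g%:R :> R by rewrite ltr0n.
have gR1 : g%:R^-1 <= 1 :> R by rewrite invf_le1// ler1n.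
have nR : 1 < n%:R :> R by rewrite ltr1n.
have dt : (d <= 2 ^ t)%N by apply: up_logP.
have td : (2 ^ t <= 2 * d.-1)%N.
  have := up_log_gtn (isT : 1 < 2)%N d1; rewrite -/t.
  have : (0 < t)%N by rewrite up_log_gt0.
  by case: t {dt} => // t' _ /=; rewrite expnS; lia.
pose T : finType := {ffun 'I_d -> 'I_g.+1}.
pose s (k : T) : R := `|f (grid_point R k)|.
pose node (k : T) (x : 'cV[R]_d) : R := 2^-1 ^+ t.+1 * (s k * Num.max 0
  (g%:R^-1 - \big[Num.max/0]_i (x i 0 - (k i)%:R / g%:R)
           - \big[Num.max/0]_i ((k i)%:R / g%:R - x i 0))).
have sn k : s k <= n%:R by rewrite ler_norml hfn//; exact: grid_point_cube.
have hnode k : reach n%:R t.+1 (4 * d + 1) (15 * d + t - 9)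
    (fun x => const_mx (node k x) : 'cV_1).
  apply: reach_hat => //; rewrite ?dt ?normr_ge0//.
  - by apply: le_trans (sn k); rewrite ler_piMr ?normr_ge0.
  - move=> i; apply: le_trans (sn k); rewrite ler_piMr ?normr_ge0// ger0_norm ?divr_ge0//.
    by have := grid_point_cube R g0 k i; rewrite mxE => /andP[].
have node0 k x : 0 <= node k x.
  by rewrite !mulr_ge0 ?exprn_ge0 ?normr_ge0 ?le_max ?lexx.
(* The factors to recover are 2^(t+1) from the node and g from [hat_scale]: with a = 2, m a / 4 =
   2^(t+1) g means m = 2^(t+2) g. The weight 2 is allowed because n > 1. *)
have m0 : (0 < 2 ^ t.+2 * g)%N by rewrite muln_gt0 expn_gt0.
have a2 : 0 <= (2 : R) <= n%:R by rewrite ler0n ler_nat.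
have b0 : `|0 : R| <= n%:R by rewrite normr0.
have [Phi [h1 h2 h3 h4 h5]] := mlp_amplify (fun k => 0 <= f (grid_point R k))
  hnode node0 m0 a2 b0.
have cardT : #|T| = (g.+1 ^ d)%N by rewrite card_ffun !card_ord.
rewrite cardT eqxx addn0 in h2 h3.
have nc := node_count_bound d1 td g0.
exists Phi; split=> //.
- by rewrite h1; lia.
- apply: leq_trans h2 _; rewrite geq_max; apply/andP; split.
    by rewrite mulnC leq_mul2r; apply/orP; right; lia.
  by move: nc; rewrite mulnAC; set N := (g.+1 ^ d)%N; nia.
- by rewrite mulnC in h3; apply: leq_trans h3 _; rewrite mulnC in nc *.
move=> x; rewrite h5 addr0 /interpolation mulr_sumr; apply: eq_bigr => k _.
rewrite hat_scale// /node /s natrM natrX exprVn.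
have t0 : (2 : R) ^+ t.+2 = 2 * 2 ^+ t.+1 by rewrite exprS.
have tn0 : (2 : R) ^+ t.+1 != 0 by rewrite expf_neq0// pnatr_eq0.
rewrite t0; case: ifP => hf0.
  by rewrite ger0_norm//; field.
by rewrite ler0_norm ?ltW// ?ltNge ?hf0//; field.
Qed.

End Construction.

(** * The one-dimensional case *)

Section OneDimension.
Variable R : realType.

(** The changes of slope of the piecewise linear interpolant of [F], starting with its slope on
    [0,1]. *)
Definition second_diff (F : nat -> R) (j : nat) : R :=
  if j is j'.+1 then F j'.+2 - 2 * F j'.+1 + F j' else F 1%N - F 0%N.

(** Each tent is a second difference of ramps, so summation by parts applies. The last two ramps,
    which vanish for u <= m + 1, are kept so that the induction on m closes. *)
Lemma sum_tents (F : nat -> R) (m : nat) (u : R) : 0 <= u ->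
  \sum_(k < m.+2) F k *
    Num.max 0 (1 - Num.max (u - k%:R) 0 - Num.max (k%:R - u) 0) =
  F 0%N + \sum_(j < m.+1) second_diff F j * Num.max 0 (u - j%:R) +
  (F m - 2 * F m.+1) * Num.max 0 (u - m.+1%:R) +
  F m.+1 * Num.max 0 (u - m.+2%:R).
Proof.
move=> u0.
have tent (y : R) : Num.max 0 (1 - Num.max y 0 - Num.max (- y) 0) =
    Num.max 0 (y + 1) - 2 * Num.max 0 y + Num.max 0 (y - 1).
  have [y0|y0] := leP 0 y.
    rewrite [Num.max (- y) 0]max_r ?oppr_le0//.
    rewrite [Num.max 0 (y + 1)]max_r ?addr_ge0// /Num.max.
    by do !case: ifP => ?; lra.
  rewrite [Num.max (- y) 0]max_l ?oppr_ge0 ?ltW//.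
  rewrite [Num.max 0 (y - 1)]max_l; last by lra.
  by rewrite /Num.max; do !case: ifP => ?; lra.
have tentk (k : nat) :
    Num.max 0 (1 - Num.max (u - k.+1%:R) 0 - Num.max (k.+1%:R - u) 0) =
    Num.max 0 (u - k%:R) - 2 * Num.max 0 (u - k.+1%:R) + Num.max 0 (u - k.+2%:R).
  rewrite -[k.+1%:R - u]opprB tent.
  have -> : u - k.+1%:R + 1 = u - k%:R by rewrite -(natr1 k); ring.
  by have -> : u - k.+1%:R - 1 = u - k.+2%:R by rewrite -(natr1 k.+1); ring.
elim: m => [|m IH].
  rewrite !big_ord_recl !big_ord0 /= /bump /= addn0 tentk.
  rewrite -[0%:R - u]opprB tent !subr0 [Num.max 0 (u + 1)]max_r ?addr_ge0//.
  by rewrite [Num.max 0 u]max_r//; ring.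
rewrite big_ord_recr IH tentk [in RHS]big_ord_recr /=; ring.
Qed.

Lemma interpolation1 (g : nat) (f : 'cV[R]_1 -> R) (x : 'cV[R]_1) :
  (0 < g)%N -> unit_cube x ->
  interpolation g f x = f 0 + g%:R * \sum_(j < g)
    second_diff (fun k => f (const_mx (k%:R / g%:R))) j *
    Num.max 0 (x 0 0 - j%:R / g%:R).
Proof.
move=> g0 hx; have gR : 0 < g%:R :> R by rewrite ltr0n.
have /andP[x0 x1] := hx 0.
pose F (k : nat) := f (const_mx (k%:R / g%:R)).
have big1max (G : 'I_1 -> R) : \big[Num.max/0]_i G i = Num.max (G ord0) 0.
  by rewrite big_ord_recl big_ord0.
rewrite /interpolation.
rewrite (reindex (fun k : 'I_g.+1 => [ffun _ : 'I_1 => k]))/=; last first.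
  exists (fun h : {ffun 'I_1 -> 'I_g.+1} => h ord0) => [k _|h _].
    by rewrite ffunE.
  by apply/ffunP => i; rewrite ffunE (ord1 i).
transitivity (\sum_(k < g.+1) F k * Num.max 0 (1 - Num.max (g%:R * x 0 0 - k%:R) 0
    - Num.max (k%:R - g%:R * x 0 0) 0)).
  apply: eq_bigr => k _; rewrite /hat !big1max !ffunE; congr (f _ * _).
  by apply/matrixP => i j; rewrite !mxE ffunE.
have ug : g%:R * x 0 0 <= g%:R by rewrite ler_piMr.
case: g g0 gR @F ug {big1max} => // m _ gR F ug.
rewrite sum_tents ?mulr_ge0//.
rewrite [Num.max 0 (_ - m.+1%:R)]max_l ?subr_le0//.
rewrite [Num.max 0 (_ - m.+2%:R)]max_l ?subr_le0; last first.
  by apply: le_trans ug _; rewrite ler_nat.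
rewrite !mulr0 !addr0; congr (_ + _).
  by rewrite /F mul0r; congr f; apply/matrixP => i j; rewrite !mxE.
rewrite mulr_sumr; apply: eq_bigr => j _.
rewrite mulrCA; congr (_ * _); rewrite maxr_pMr ?ltW// mulr0 mulrBr.
by rewrite [_ * (_ / _)]mulrC divfK ?gt_eqF.
Qed.

(* In dimension one the values of f are too large for the amplification to fit
   into the parameter budget, whereas its increments on the grid are small. *)
Lemma interpolation_mlp1 (n g : nat) (f : 'cV[R]_1 -> R) :
  (1 < n)%N -> (0 < g)%N -> `|f 0| <= n%:R ->
  (forall k, (k < g)%N ->
    `|f (const_mx (k.+1%:R / g%:R)) - f (const_mx (k%:R / g%:R))| <= 1) ->
  exists Phi : mlp R 1 1,
    [/\ (mlp_depth Phi <= 4)%N, (mlp_width Phi <= 8 * g.+1)%N,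
        (mlp_nnz Phi <= 16 * g.+1)%N, admissible n%:R Phi
      & forall x, unit_cube x -> mlp_fun Phi x = interpolation g f x].
Proof.
move=> n1 g0 f0 hstep; have gR : 0 < g%:R :> R by rewrite ltr0n.
have n2 : 2 <= n%:R :> R by rewrite ler_nat.
pose D (j : 'I_g) : R := second_diff (fun k => f (const_mx (k%:R / g%:R))) j.
(* Beyond the initial slope, a change of slope is a difference of two increments, hence at most 2 <=
   n. *)
have hD j : `|D j| <= n%:R.
  apply: le_trans n2; rewrite /D; case: j => -[|j] jg /=.
    by apply: le_trans (hstep _ jg) _; rewrite ler1n.
  have := hstep _ jg; have := hstep _ (ltnW jg).
  by rewrite !ler_norml => /andP[? ?] /andP[? ?]; apply/andP; split; lra.
have hb j : `|- (`|D j| * (j%:R / g%:R))| <= n%:R.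
  rewrite normrN normrM normr_id; apply: le_trans (hD j).
  rewrite ler_piMr// ger0_norm ?divr_ge0// ler_pdivrMr// mul1r ler_nat.
  exact: ltnW.
have hs j : `| `|D j| | <= n%:R by rewrite normr_id.
pose node j (x : 'cV[R]_1) : R :=
  Num.max 0 (`|D j| * x 0 0 + - (`|D j| * (j%:R / g%:R))).
have hnode j : reach n%:R 0 1 2 (fun x => const_mx (node j x) : 'cV_1).
  exact: reach_affine.
have node0 j x : 0 <= node j x by rewrite le_max lexx.
(* With a = 2, taking m = 2 g gives m a / 4 = g, the factor in [interpolation1]. *)
have m0 : (0 < 2 * g)%N by rewrite muln_gt0.
have a2 : 0 <= (2 : R) <= n%:R by rewrite ler0n n2.
have [Phi [h1 h2 h3 h4 h5]] := mlp_amplify (fun j => 0 <= D j) hnode node0 m0 a2 f0.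
rewrite card_ord in h2 h3.
exists Phi; split=> //.
- by rewrite h1.
- by apply: leq_trans h2 _; lia.
- by apply: leq_trans h3 _; case: (f 0 != 0); lia.
move=> x hx; rewrite h5 interpolation1// addrC; congr (_ + _).
have -> : (2 * g)%:R * 2 / 4 = g%:R :> R by rewrite natrM; field.
congr (_ * _); apply: eq_bigr => j _; rewrite /node -mulrBr -/(D j).
set y := x 0 0 - _.
have -> : Num.max 0 (`|D j| * y) = `|D j| * Num.max 0 y by rewrite maxr_pMr// mulr0.
case: ifP => hj; first by rewrite ger0_norm.
by rewrite -mulNr ltr0_norm ?opprK// ltNge hj.
Qed.

End OneDimension.

(** * Degenerate cases and assembly *)

Lemma const_mlp (R : realType) (d n : nat) (alpha L b : R) : 0 <= L ->
  `|b| <= n%:R -> exists Phi : mlp R 1 d,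
    [/\ forall D W, NN L alpha n D W Phi, (mlp_nnz Phi <= 1)%N
      & forall x, mlp_fun Phi x = b].
Proof.
move=> L0 hb; exists (Output 0 (const_mx b)).
have ev x : mlp_fun (Output (0 : 'M[R]_(1, d)) (const_mx b)) x = b.
  by rewrite /mlp_fun /= mul0mx add0r mxE.
split=> // [D W|].
  split=> //; first by move=> x y _ _; rewrite !ev subrr normr0 mulr_ge0// powR_ge0.
  by split=> i j; rewrite mxE// normr0.
by rewrite /= nnz0 add0n; apply: leq_trans (nnz_le _) _.
Qed.

Theorem theorem1p1 (R : realType) (d n : nat) (alpha L : R)
    (hd : (0 < d)%N) (hn : (0 < n)%N) (halpha : 0 < alpha <= 1) (hL : 0 <= L)
    (f : 'cV[R]_d -> R)
    (hfn : forall x, unit_cube x -> - n%:R <= f x <= n%:R)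
    (hf : holder_on (@unit_cube R d) L alpha f) :
  exists (D W : nat) (Phi : mlp R 1 d),
    [/\ NN L alpha n D W Phi,
        W%:Z <= 8 * d%:Z * (grid_size d n L alpha + 1) ^+ d,
        D%:Z <= Num.ceil (log2 (d%:R : R)) + 4,
        (mlp_nnz Phi)%:Z <= 16 * d%:Z * (grid_size d n L alpha + 1) ^+ d
      & forall x, unit_cube x -> `|f x - mlp_fun Phi x| <= d%:R / n%:R].
Proof.
have a0 : 0 < alpha by case/andP: halpha.
have nR : 0 < n%:R :> R by rewrite ltr0n.
have dR : 0 < d%:R :> R by rewrite ltr0n.
set A := (L * n%:R / d%:R `^ (1 - alpha)) `^ alpha^-1.
have A0 : 0 <= A by exact: powR_ge0.
have [g eg] : exists g : nat, grid_size d n L alpha = g%:Z.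
  exists `|grid_size d n L alpha|%N; rewrite gez0_abs// /grid_size ceil_ge0.
  by rewrite -/A; lra.
have hA : 2^-1 * A <= g%:R.
  by have := ceil_ge (2^-1 * A); rewrite -[Num.ceil _]/(grid_size d n L alpha) eg.
have bound (c N : nat) : (N <= c * d * g.+1 ^ d)%N ->
    N%:Z <= c%:Z * d%:Z * (grid_size d n L alpha + 1) ^+ d.
  move=> h; rewrite eg (_ : g%:Z + 1 = g.+1%:Z); last by lia.
  by rewrite -[g.+1%:Z]natz -natrX natz -!PoszM lez_nat.
have hdepth : (up_log 2 d + 4)%:Z <= Num.ceil (log2 (d%:R : R)) + 4.
  by rewrite PoszD lerD2r up_log_le_ceil.
pose W := (8 * d * g.+1 ^ d)%N.
suff [Phi [hPhi hnnz herr]] : exists Phi : mlp R 1 d,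
    [/\ NN L alpha n (up_log 2 d + 4) W Phi, (mlp_nnz Phi <= 16 * d * g.+1 ^ d)%N
      & forall x, unit_cube x -> `|f x - mlp_fun Phi x| <= d%:R / n%:R].
  exists (up_log 2 d + 4)%N, W, Phi; split=> //; exact: bound.
have const b : `|b| <= n%:R ->
    (forall x, unit_cube x -> `|f x - b| <= d%:R / n%:R) ->
    exists Phi : mlp R 1 d,
      [/\ NN L alpha n (up_log 2 d + 4) W Phi, (mlp_nnz Phi <= 16 * d * g.+1 ^ d)%N
        & forall x, unit_cube x -> `|f x - mlp_fun Phi x| <= d%:R / n%:R].
  move=> hb herr; have [Phi [h1 h2 h3]] := @const_mlp R d n alpha L b hL hb.
  exists Phi; split=> //; last by move=> x hx; rewrite h3 herr.
  by apply: leq_trans h2 _; rewrite !muln_gt0 hd expn_gt0.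
(* For n = 1, |f| <= 1 <= d / n and the zero network suffices. *)
have [n1|n1] := leqP n 1.
  have en : n = 1%N by lia.
  apply: (const 0) => [|x hx]; first by rewrite normr0.
  rewrite subr0 en divr1; apply: le_trans (_ : 1 <= _); last by rewrite ler1n.
  by rewrite ler_norml -[1]/(1%:R) -en hfn.
have cube0 : unit_cube (0 : 'cV[R]_d) by move=> i; rewrite mxE lexx ler01.
have [g0|g0] := posnP g.
  (* A grid size 0 forces L = 0, so f is constant on the cube. *)
  have L0 : L = 0.
    have AA : A = 0 by apply/le_anti; rewrite A0 andbT; move: hA; rewrite g0; lra.
    move/powR_eq0_eq0: AA => /eqP; rewrite !mulf_eq0 invr_eq0.
    by rewrite (gt_eqF (powR_gt0 _ dR)) (gt_eqF nR) !orbF => /eqP.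
  apply: (const (f 0)) => [|x hx]; first by rewrite ler_norml hfn.
  apply: le_trans (hf _ _ hx cube0) _; rewrite L0 mul0r divr_ge0//.
have herr x : unit_cube x -> `|f x - interpolation g f x| <= d%:R / n%:R.
  move=> hx; apply: le_trans (interpolation_error halpha hL g0 hf hx) _.
  exact: holder_grid_bound.
have [Phi [h1 h2 h3 h4 h5]] : exists Phi : mlp R 1 d,
    [/\ (mlp_depth Phi <= up_log 2 d + 4)%N, (mlp_width Phi <= W)%N,
        (mlp_nnz Phi <= 16 * d * g.+1 ^ d)%N, admissible n%:R Phi
      & forall x, unit_cube x -> mlp_fun Phi x = interpolation g f x].
  have [d1|d1] := leqP d 1; last first.
    have [Phi [h1 h2 h3 h4 h5]] := interpolation_mlp d1 n1 g0 hfn.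
    by exists Phi; split=> //; rewrite h1.
  have ed : d = 1%N by lia.
  subst d; rewrite /W !muln1 expn1.
  apply: interpolation_mlp1 => //; first by rewrite ler_norml hfn.
  move=> k kg.
  have gR : 0 < g%:R :> R by rewrite ltr0n.
  pose p (y : R) : 'cV[R]_1 := const_mx (y / g%:R).
  have cube y : 0 <= y <= g%:R -> unit_cube (p y).
    move=> /andP[y0 yg] i; rewrite mxE divr_ge0// ?ler_pdivrMr ?mul1r//; exact: ltW.
  (* [holder_grid_bound] with d = 1 bounds increments over half a cell by 1/n <= 1/2; passing
     through the midpoint bounds those over a cell by 1. *)
  have half y z : 0 <= y <= g%:R -> 0 <= z <= g%:R -> `|y - z| = 2^-1 ->
      `|f (p y) - f (p z)| <= 2^-1.
    move=> hy hz yz; apply: le_trans (hf _ _ (cube y hy) (cube z hz)) _.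
    have -> : norm1 (p y - p z) = 1%:R / (2 * g%:R).
      rewrite /norm1 big_ord1 !mxE -mulrBl normrM yz gtr0_norm ?invr_gt0//.
      by rewrite invfM mul1r.
    apply: le_trans (holder_grid_bound _ _ _ _ _ hA) _ => //.
    by rewrite mul1r lef_pV2 ?posrE// ler_nat.
  have kR : k.+1%:R <= g%:R :> R by rewrite ler_nat.
  have k1 : k.+1%:R = k%:R + 1 :> R by rewrite natr1.
  have k0 : 0 <= k%:R :> R by [].
  rewrite k1 in kR *.
  have h1 := @half (k%:R + 1) (k%:R + 2^-1) ltac:(lra) ltac:(lra).
  have h2 := @half (k%:R + 2^-1) k%:R ltac:(lra) ltac:(lra).
  have -> : f (const_mx ((k%:R + 1) / g%:R)) - f (const_mx (k%:R / g%:R)) =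
      (f (p (k%:R + 1)) - f (p (k%:R + 2^-1))) + (f (p (k%:R + 2^-1)) - f (p k%:R)).
    by rewrite /p; ring.
  apply: le_trans (ler_normD _ _) _.
  rewrite [leRHS](_ : 1 = 2^-1 + 2^-1); last by field.
  apply: lerD; [apply: h1|apply: h2].
    by rewrite ger0_norm; lra.
  by rewrite ger0_norm; lra.
exists Phi; split=> //; last by move=> x hx; rewrite h5// herr.
split=> // x y hx hy; rewrite !h5//; exact: interpolation_holder.
Qed.
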